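(* Let $k$ be an algebraically closed field, $n\ge 1$, and let $L=(L_i)_{1\le i\le n^2}\in\mathcal{P}(k^n)$ be a polynomial operator curve such that $\Sigma(L)=\bar{\Sigma}(L)\neq k$. Then $$\sum_{\lambda\in\Sigma(L)}\mathfrak{m}[L,\lambda]=\sum_{\lambda\in\Sigma(L)}i(\pi^{-1}(\mathcal{S}(k^n)),\mathcal{R}(L);(L(\lambda),\lambda))=dn,$$ where $d:=\max_i\deg(L_i(\lambda))$.
   Context: $\mathcal{L}(k^n)$ is the space of linear maps $k^n\to k^n$, identified with $n\times n$ matrices and with affine space $\operatorname{Spec}k[x_1,\dots,x_{n^2}]$ (the $x_i$ being the matrix entries). $\mathcal{S}(k^n)$ is the subscheme of non-invertible maps, $\operatorname{Spec}(k[x_1,\dots,x_{n^2}]/\mathfrak{D})$ with $\mathfrak{D}=\langle\det(x_1,\dots,x_{n^2})\rangle$. $\mathcal{P}(k^n)$ is the set of polynomial operator curves $L(\lambda)=\sum_{i=0}^m T_i\lambda^i$ with $T_i\in\mathcal{L}(k^n)$, $T_m\ne 0$. Write $L(\lambda)=(L_i(\lambda))_{1\le i\le n^2}$ for its entries, $L_i\in k[\lambda]$. The spectrum is $\Sigma(L)=\{\lambda\in k:\det(L(\lambda))=0\}$, and for $\lambda_0\in\Sigma(L)$ the algebraic multiplicity is $\mathfrak{m}[L,\lambda_0]=\operatorname{ord}_{\lambda=\lambda_0}\det(L(\lambda))$. Projective spectrum: let $d=\max_i\deg(L_i)$, $\mathbb{P}\mathcal{L}(k^n)=\operatorname{Proj}k[x_0,x_1,\dots,x_{n^2}]$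 and $$\bar L:\mathbb{P}^1(k)\to\mathbb{P}\mathcal{L}(k^n),\quad [\lambda:\mu]\mapsto[\mu^d:\mu^dL_1(\lambda/\mu):\dots:\mu^dL_{n^2}(\lambda/\mu)].$$ Then $\bar\Sigma(L)=\Sigma(L)\cup\Sigma_\infty(L)$, where $\Sigma_\infty(L)=\emptyset$ if $\det(\bar L([\lambda:0]))\ne 0$ and $\Sigma_\infty(L)=\{\infty\}$ if $\det(\bar L([\lambda:0]))=0$; here $\det$ is the homogeneous polynomial $\det(x_1,\dots,x_{n^2})$ evaluated on the coordinates $x_1,\dots,x_{n^2}$ of the point $\bar L([\lambda:0])$. The resolution of $L$ is the scheme $$\mathcal{R}(L)=\operatorname{Spec}\left(\frac{k[\lambda,x_1,\dots,x_{n^2}]}{\mathfrak{P}_L}\right),\qquad \mathfrak{P}_L=\langle x_1-L_1(\lambda),\dots,x_{n^2}-L_{n^2}(\lambda)\rangle.$$ $\pi:\operatorname{Spec}k[\lambda,x_1,\dots,x_{n^2}]\to\operatorname{Spec}k[x_1,\dots,x_{n^2}]$ is the projection forgetting $\lambda$, so $\pi^{-1}(\mathcal{S}(k^n))$ is the closed subscheme of $\operatorname{Spec}k[\lambda,x_1,\dots,x_{n^2}]$ defined by the ideal $\langle\det(x_1,\dots,x_{n^2})\rangle$. A point $(T,\lambda)$ has matrix coordinates $T$ and parameter coordinate $\lambda$. Intersection multiplicity (Serre): for subvarieties $X_1,X_2$ of a smooth variety $X$ intersecting properly, and $c$ an isolated point of $X_1\cap X_2$, with ideals $\mathfrak{P}_{X_1},\mathfrak{P}_{X_2}$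 in the local ring $\mathcal{O}_{c,X}$, $$i(X_1,X_2;c)=\sum_{i=0}^{\dim X}(-1)^i\,\ell_{\mathcal{O}_{c,X}}\operatorname{Tor}_i^{\mathcal{O}_{c,X}}(\mathcal{O}_{c,X}/\mathfrak{P}_{X_1},\mathcal{O}_{c,X}/\mathfrak{P}_{X_2}),$$ where $\ell$ is module length. When $X_1,X_2$ are Cohen--Macaulay this equals $\ell_{\mathcal{O}_{c,X}}(\mathcal{O}_{c,X}/(\mathfrak{P}_{X_1}+\mathfrak{P}_{X_2}))$. Here $X=\operatorname{Spec}k[\lambda,x_1,\dots,x_{n^2}]$. *)

(* Defs.v *)
From HB Require Import structures.
From mathcomp Require Import all_boot all_order all_algebra.
From mathcomp Require Import fraction.
From mathcomp.multinomials Require Import mpoly.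
From mathcomp Require Import boolp classical_sets fsbigop.

Set Implicit Arguments.
Unset Strict Implicit.
Unset Printing Implicit Defensive.

Import GRing.Theory.

Local Open Scope ring_scope.
Local Open Scope classical_set_scope.

(** * Submodules, ideals, length *)

Definition submodule (A : comNzRingType) (V : lmodType A) (N : set V) : Prop :=
  N 0 /\ forall (a : A) (u v : V), N u -> N v -> N (a *: u + v).

Definition ideal (A : comNzRingType) (I : set A) : Prop :=
  @submodule A A^o I.

Definition ideal_gen (A : comNzRingType) (G : set A) : set A :=
  smallest (@ideal A) G.

(* A subquotient Z / B of V is represented by the pair (Z, B); its submodules
   are the submodules of V between B and Z. *)
Definition has_chain (A : comNzRingType) (V : lmodType A) (Z B : set V)
    (l : nat) : Prop :=
  exists N : nat -> set V,
    [/\ forall i, (i <= l)%N -> submodule (N i),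
        B `<=` N 0%N,
        N l `<=` Z
      & forall i, (i < l)%N -> N i `<` N i.+1].

(* The module Z / B has finite length l. *)
Definition has_length (A : comNzRingType) (V : lmodType A) (Z B : set V)
    (l : nat) : Prop :=
  has_chain Z B l /\ forall m, has_chain Z B m -> (m <= l)%N.

(** * Tor of two cyclic modules *)

(* A resolution  ... -> A^(r 2) -> A^(r 1) -> A^(r 0) -> A / I -> 0  by free
   modules of finite rank.  Elements of A^r are row vectors and maps act by
   right multiplication; the augmentation A^(r 0) -> A / I is the class of
   right multiplication by the column [res_aug].  Over a Noetherian ring such
   resolutions exist and compute Tor. *)
Record free_resolution (A : comNzRingType) (I : set A) := FreeResolution {
  res_rank : nat -> nat;
  res_diff : forall i, 'M[A]_(res_rank i.+1, res_rank i);
  res_aug : 'cV[A]_(res_rank 0);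
  res_surj : forall a : A, exists v : 'rV_(res_rank 0),
    I (a - (v *m res_aug) 0 0);
  res_exact0 : forall v : 'rV_(res_rank 0),
    I ((v *m res_aug) 0 0) <-> exists w, v = w *m res_diff 0;
  res_exactS : forall i (v : 'rV_(res_rank i.+1)),
    v *m res_diff i = 0 <-> exists w, v = w *m res_diff i.+1
}.

Section Tor.
Variables (A : comNzRingType) (I J : set A) (F : free_resolution I).

(* Tor_i(A / I, A / J) is the homology in degree i of the complex with terms
   A^(r i) (x) A / J = A^(r i) / J^(r i); lifted to A^(r i), the cycles and
   the boundaries are the following submodules. *)
Definition Tor_cycles (i : nat) : set 'rV[A]_(res_rank F i) :=
  match i with
  | 0 => setT
  | i'.+1 => [set v | forall j, J ((v *m res_diff F i') 0 j)]
  end.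

Definition Tor_boundaries (i : nat) : set 'rV[A]_(res_rank F i) :=
  [set v | exists w, forall j, J ((v - w *m res_diff F i) 0 j)].

Definition Tor_has_length (i l : nat) : Prop :=
  has_length (@Tor_cycles i) (@Tor_boundaries i) l.

End Tor.

(** * Local rings of affine space *)

Section LocalRing.
Variables (k : fieldType) (N : nat) (c : 'I_N -> k).

Definition regular_at : {pred {fraction {mpoly k[N]}}} :=
  fun f => `[< exists p q : {mpoly k[N]},
                 q.@[c] != 0 /\ f = tofrac p / tofrac q >].

Fact regular_at_subring : subring_closed regular_at.
Proof.
have nz (q : {mpoly k[N]}) : q.@[c] != 0 -> tofrac q != 0.
  by rewrite tofrac_eq0; apply: contraNneq => ->; rewrite meval0.
split=> [|f g /asboolP[p [q [q0 ->]]] /asboolP[p' [q' [q'0 ->]]]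
         |f g /asboolP[p [q [q0 ->]]] /asboolP[p' [q' [q'0 ->]]]];
  apply/asboolP.
- by exists 1, 1; rewrite meval1 oner_neq0 rmorph1 divr1.
- exists (p * q' - p' * q), (q * q'); rewrite mevalM mulf_neq0 //; split=> //.
  by rewrite -mulNr addf_div ?nz // mulNr rmorphB !rmorphM.
- exists (p * p'), (q * q'); rewrite mevalM mulf_neq0 //; split=> //.
  by rewrite mulf_div !rmorphM.
Qed.

HB.instance Definition _ :=
  GRing.isSubringClosed.Build _ regular_at regular_at_subring.

(* The local ring at c of the affine space Spec k[x_0, ..., x_(N-1)]. *)
Record local_ring := LocalRing {
  local_frac : {fraction {mpoly k[N]}};
  _ : local_frac \in regular_at
}.

HB.instance Definition _ := [isSub for local_frac].
HB.instance Definition _ := [Choice of local_ring by <:].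
HB.instance Definition _ := [SubChoice_isSubComNzRing of local_ring by <:].

Fact tofrac_regular (p : {mpoly k[N]}) : tofrac p \in regular_at.
Proof.
by apply/asboolP; exists p, 1; rewrite meval1 oner_neq0 rmorph1 divr1.
Qed.

Definition to_local (p : {mpoly k[N]}) : local_ring :=
  LocalRing (tofrac_regular p).

Definition ideal_at (I : set {mpoly k[N]}) : set local_ring :=
  ideal_gen (to_local @` I).

End LocalRing.

Arguments ideal_at {k N} c I _.

(** * Serre's intersection multiplicity in affine space *)

Section SerreMultiplicity.
Variables (k : fieldType) (N : nat) (I J : set {mpoly k[N]}) (c : 'I_N -> k).

(* e is the alternating sum of the lengths of the modules Tor_i, 0 <= i <= N;
   all of them are required to be finite.  Asking for every resolution to
   yield e makes e unique. *)
Definition is_intersection_mult (e : int) : Prop :=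
  inhabited (free_resolution (ideal_at c I)) /\
  forall F : free_resolution (ideal_at c I),
    exists2 l : nat -> nat,
      forall i, (i <= N)%N -> Tor_has_length (ideal_at c J) F i (l i)
      & e = \sum_(i < N.+1) (-1) ^+ i * (l i)%:Z.

Definition intersection_mult : int := xget 0 is_intersection_mult.

End SerreMultiplicity.

(** * Operator curves *)

Section Curves.
Variables (k : closedFieldType) (n : nat).

Definition operator_curve (L : 'M[{poly k}]_n) : Prop :=
  exists (m : nat) (T : nat -> 'M[k]_n),
    T m != 0 /\ L = \sum_(i < m.+1) 'X^i *: map_mx polyC (T i).

Variable L : 'M[{poly k}]_n.

Definition curve_eval (x : k) : 'M[k]_n := \matrix_(i, j) (L i j).[x].

Definition Sigma : set k := [set x | \det (curve_eval x) = 0].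

Definition alg_mult (x : k) : nat := mup x (\det L).

Definition curve_deg : nat := \max_(ij : 'I_n * 'I_n) (size (L ij.1 ij.2)).-1.

(* mu^d L_ij(l / mu), expanded as a homogeneous polynomial so that it makes
   sense for mu = 0; the first component is the coordinate x_0. *)
Definition curve_bar (l mu : k) : k * 'M[k]_n :=
  (mu ^+ curve_deg,
   \matrix_(i, j) \sum_(t < curve_deg.+1)
      (L i j)`_t * l ^+ t * mu ^+ (curve_deg - t)).

(* P^1(k) is encoded as [option k], [None] being the point at infinity
   [1 : 0]. *)
Definition Sigma_infty : set (option k) :=
  [set y | y = None /\ \det (curve_bar 1 0).2 = 0].

Definition Sigma_bar : set (option k) := (Some @` Sigma) `|` Sigma_infty.

(** * The intersection problem
   The ring k[lambda, x_1, ..., x_(n^2)] is {mpoly k[1 + n * n]}: the variable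
   of index 0 is lambda, the others are the matrix entries. *)

Definition param_idx : 'I_(1 + n * n) := lshift (n * n) ord0.

Definition entry_idx (i j : 'I_n) : 'I_(1 + n * n) :=
  rshift 1 (mxvec_index i j).

Definition singular_ideal : set {mpoly k[1 + n * n]} :=
  ideal_gen
    [set \det (\matrix_(i, j) ('X_(entry_idx i j) : {mpoly k[1 + n * n]}))].

Definition resolution_ideal : set {mpoly k[1 + n * n]} :=
  ideal_gen [set 'X_(entry_idx ij.1 ij.2)
                 - (map_poly (@mpolyC (1 + n * n) k) (L ij.1 ij.2)).['X_param_idx]
            | ij in [set: 'I_n * 'I_n]].

(* The point (L(x), x). *)
Definition curve_point (x : k) : 'I_(1 + n * n) -> k :=
  fun u => match split u with
           | inl _ => x
           | inr v => mxvec (curve_eval x) 0 v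
           end.

End Curves.

Arguments singular_ideal : clear implicits.

(* Main.v *)
(** Substituting L for the matrix entries identifies k[lambda, x] / P_L with
    k[lambda], and sends the generic determinant D to det L.  Locally at a
    point of the curve, A / P_L is thus a discrete valuation ring in which D is
    regular of order m[L, lambda].  Since A / D has the resolution
    0 -> A -> A -> A / D -> 0, the higher Tor vanish and Tor_0 = A / (D, P_L)
    has length m[L, lambda].  An arbitrary free resolution of A / D is compared
    with this one by explicit chain homotopies.  Finally the absence of spectrum
    at infinity says that the coefficient of degree dn of det L, which is the
    determinant of the coefficients of degree d of L, is nonzero; so det L has
    degree dn and dn roots counted with multiplicity. *)

Require Import Defs.
From HB Require Import structures.
From mathcomp Require Import all_boot all_order all_algebra.
From mathcomp Require Import fraction.
From mathcomp.multinomials Require Import mpoly.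
From mathcomp Require Import boolp classical_sets fsbigop.
From mathcomp Require Import ring.

Set Implicit Arguments.
Unset Strict Implicit.
Unset Printing Implicit Defensive.

Import GRing.Theory.

Local Open Scope ring_scope.
Local Open Scope classical_set_scope.

(** * Length of subquotients *)

(** When the submodules between [B] and [Z] form a single finite flag, a strict chain among them
    amounts to a strictly increasing sequence of indices in [0..m], so it has at most [m] steps. *)
Lemma has_length_flag (A : comNzRingType) (V : lmodType A) (Z B : set V)
    (m : nat) (G : nat -> set V) :
  (forall i, (i <= m)%N -> submodule (G i)) -> G 0%N = B -> G m = Z ->
  (forall i, (i < m)%N -> G i `<` G i.+1) ->
  (forall N, submodule N -> B `<=` N -> N `<=` Z ->
    exists2 i, (i <= m)%N & N = G i) ->
  has_length Z B m.
Proof.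
move=> Gsub G0 Gm Glt Gall; split.
  by exists G; split=> //; rewrite ?G0 ?Gm.
have Gle i j : (i <= j)%N -> (j <= m)%N -> G i `<=` G j.
  elim: j => [|j IHj]; first by rewrite leqn0 => /eqP-> _ x.
  rewrite leq_eqVlt => /predU1P[-> _ x //|lt_ij] lt_jm.
  exact: subset_trans (IHj lt_ij (ltnW lt_jm)) (properW (Glt j lt_jm)).
move=> l [N [Nsub BN NZ Nlt]].
have Nbelow i j : (i + j <= l)%N -> N i `<=` N (i + j)%N.
  elim: j => [|j IHj]; first by rewrite addn0 => _ x.
  rewrite addnS => lt_jl.
  exact: subset_trans (IHj (ltnW lt_jl)) (properW (Nlt _ lt_jl)).
have idx i : (i <= l)%N -> exists j, [/\ (i <= j)%N, (j <= m)%N & N i = G j].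
  elim: i => [|i IHi] le_il.
    have [|||j le_jm ->] := Gall (N 0%N); [exact: Nsub|exact: BN| |by exists j].
    by apply: subset_trans NZ; have := Nbelow 0%N l; rewrite add0n; apply.
  have [j [le_ij le_jm Nij]] := IHi (ltnW le_il).
  have [|||j' le_j'm Nij'] := Gall (N i.+1).
  - exact: Nsub.
  - apply: subset_trans BN _; have := Nbelow 0%N i.+1.
    by rewrite add0n; apply.
  - apply: subset_trans NZ; have := Nbelow i.+1 (l - i.+1)%N.
    by rewrite subnKC //; apply.
  (* An index [j' <= j] would give [N i.+1 = G j' <= G j = N i], against strictness. *)
  exists j'; split=> //; apply: leq_ltn_trans le_ij _.
  rewrite ltnNge; apply/negP => le_j'j.
  have [_] := Nlt _ le_il; apply; rewrite Nij Nij'; exact: Gle.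
by have [j [le_lj le_jm _]] := idx l (leqnn l); apply: leq_trans le_jm.
Qed.

Lemma has_length_inj (A : comNzRingType) (V : lmodType A) (Z B : set V)
    (l m : nat) :
  has_length Z B l -> has_length Z B m -> l = m.
Proof.
by move=> [Cl ul] [Cm um]; apply/eqP; rewrite eqn_leq ul ?um.
Qed.

(** * Ideals and their generators *)

Section Ideal.
Variables (A : comNzRingType) (I : set A).
Hypothesis I_id : ideal I.

Lemma ideal0 : I 0. Proof. by case: I_id. Qed.

Lemma idealD a b : I a -> I b -> I (a + b).
Proof. by move=> Ia Ib; have := I_id.2 1 a b Ia Ib; rewrite scale1r. Qed.

Lemma idealMl a b : I b -> I (a * b).
Proof. by move=> Ib; have := I_id.2 a b 0 Ib ideal0; rewrite addr0. Qed.

Lemma idealMr a b : I a -> I (a * b).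
Proof. by rewrite mulrC; apply: idealMl. Qed.

Lemma idealB a b : I a -> I b -> I (a - b).
Proof.
by move=> Ia Ib; apply: idealD => //; rewrite -mulN1r; apply: idealMl.
Qed.

Lemma ideal_mulmx (p q r : nat) (M : 'M[A]_(p, q)) (P : 'M_(q, r)) i j :
  (forall l, I (M i l)) -> I ((M *m P) i j).
Proof.
move=> IM; rewrite mxE; elim/big_ind: _ => [|a b|l _].
- exact: ideal0.
- exact: idealD.
- exact/idealMr/IM.
Qed.

End Ideal.

Lemma ideal_gen_ideal (A : comNzRingType) (G : set A) : ideal (ideal_gen G).
Proof.
split=> [|a u v Iu Iv] N [N_id GN]; first exact: ideal0 N_id.
by apply: N_id.2; [apply: Iu|apply: Iv].
Qed.

Lemma ideal_gen1 (A : comNzRingType) (D a : A) :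
  ideal_gen [set D] a <-> exists b, a = b * D.
Proof.
split=> [|[b ->]]; last first.
  by apply: (idealMl (ideal_gen_ideal _)); apply: sub_gen_smallest.
apply: (@smallest_sub _ _ _ [set a | exists b, a = b * D]) => [|_ ->];
  last first.
  by exists 1; rewrite mul1r.
split=> [|c u v [b ->] [b' ->]]; first by exists 0; rewrite mul0r.
by exists (c * b + b'); rewrite mulrDl -mulrA.
Qed.

(** * Tor of the quotient by a regular element *)

Section PrincipalTor.
Variables (A : comNzRingType) (D : A) (I J : set A).
Hypothesis I_D : forall a, I a <-> exists b, a = b * D.
Hypothesis D_reg : forall a, a * D = 0 -> a = 0.
Hypothesis J_id : ideal J.

Lemma principal_ideal : ideal I.
Proof.
split=> [|c u v /I_D[b ->] /I_D[b' ->]]; apply/I_D.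
  by exists 0; rewrite mul0r.
by exists (c * b + b'); rewrite mulrDl -mulrA.
Qed.
Let I_id := principal_ideal.

(** Multiplication by [D] is injective, so [0 -> A -> A] is exact on the left; the ranks are 1, 1,
    0, 0, ... *)
Lemma principal_free_resolution : inhabited (free_resolution I).
Proof.
pose rk i := match i with 0 | 1 => 1%N | _ => 0%N end.
pose df i : 'M[A]_(rk i.+1, rk i) :=
  match i return 'M[A]_(rk i.+1, rk i) with 0 => D%:M | _ => 0 end.
exists; apply: (@FreeResolution _ I rk df (1%:M : 'M_1)) => [a|v|[|i] v].
- by exists a%:M; rewrite mulmx1 mxE subrr; apply: ideal0.
- rewrite mulmx1; split=> [/I_D[b vb]|[w ->]].
    exists b%:M; apply/matrixP=> s t.
    by rewrite (ord1 s) (ord1 t) vb -scalar_mxM mxE.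
  by apply/I_D; exists (w 0 0); rewrite /df mul_mx_scalar mxE mulrC.
- split=> [v0|[w ->]]; last by rewrite -mulmxA mul0mx mulmx0.
  exists 0; rewrite mul0mx; apply/matrixP=> s t.
  move/matrixP/(_ 0 0): v0; rewrite /df mul_mx_scalar !mxE mulrC => /D_reg.
  by rewrite (ord1 s) (ord1 t).
- by split=> _; [exists 0; apply/matrixP=> s []|rewrite mulmx0].
Qed.

Variable F : free_resolution I.
Local Notation d := (@res_diff _ _ F).
Local Notation aug := (res_aug F).

Lemma lift_res_diff0 (p : nat) (M : 'M_(p, res_rank F 0)) :
  (forall l, I ((M *m aug) l 0)) -> exists S, M = S *m d 0.
Proof.
move=> IM.
have /fin_all_exists[f Mf] l : exists w, row l M = w *m d 0.
  by apply/res_exact0; rewrite -row_mul mxE.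
by exists (\matrix_l f l); apply/row_matrixP=> l; rewrite row_mul rowK.
Qed.

Lemma lift_res_diffS (i p : nat) (M : 'M_(p, res_rank F i.+1)) :
  M *m d i = 0 -> exists S, M = S *m d i.+1.
Proof.
move=> M0.
have /fin_all_exists[f Mf] l : exists w, row l M = w *m d i.+1.
  by apply/res_exactS; rewrite -row_mul M0 row0.
by exists (\matrix_l f l); apply/row_matrixP=> l; rewrite row_mul rowK.
Qed.

Lemma res_diff_aug l : I ((d 0 *m aug) l 0).
Proof.
have [_] := res_exact0 (row l (d 0)).
by rewrite -row_mul mxE; apply; exists (delta_mx 0 l); rewrite rowE.
Qed.

Lemma res_diffK i : d i.+1 *m d i = 0.
Proof.
apply/row_matrixP=> l; rewrite row_mul row0; apply/res_exactS.
by exists (delta_mx 0 l); rewrite rowE.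
Qed.

Lemma aug_section : exists u : 'rV_(res_rank F 0), I (1 - (u *m aug) 0 0).
Proof. exact: res_surj. Qed.

(* The comparison maps between F and the resolution 0 -> A -> A, followed by a
   contracting homotopy of the difference with the identity. *)
Lemma contraction1 : exists f1 : 'cV_(res_rank F 1), exists g1 S0 S1,
  d 0 *m aug = D *: f1 /\
  1%:M = f1 *m g1 + d 0 *m S0 + S1 *m d 1 :> 'M_(res_rank F 1).
Proof.
have [u] := aug_section; set e := (u *m aug) 0 0 => Iu.
(* Since [e] is 1 modulo [I], the endomorphism [1 - aug *m u] has augmentation in [I] and factors
   through [d 0]. *)
have [S0 S0P] : exists S0, 1%:M - aug *m u = S0 *m d 0.
  apply: lift_res_diff0 => l; rewrite mulmxBl mul1mx -mulmxA.
  rewrite [u *m aug]mx11_scalar -/e mul_mx_scalar !mxE.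
  by rewrite -[X in X - _]mul1r -mulrBl; apply: idealMr.
have /fin_all_exists[f f1P] l : exists b, (d 0 *m aug) l 0 = b * D.
  by apply/I_D/res_diff_aug.
pose f1 : 'cV_(res_rank F 1) := \col_l f l.
have f1D : d 0 *m aug = D *: f1.
  by apply/matrixP=> l j; rewrite (ord1 j) f1P !mxE mulrC.
(* [u] and [g1] are the two components of the comparison map from [0 -> A -> A] to [F]; [aug] and
   [f1] are those of the map back. *)
have [g1 g1P] : exists g1, D *: u = g1 *m d 0.
  apply: lift_res_diff0 => l; rewrite -scalemxAl mxE.
  by apply: idealMr => //; apply/I_D; exists 1; rewrite mul1r.
have [S1 S1P] : exists S1, 1%:M - f1 *m g1 - d 0 *m S0 = S1 *m d 1.
  apply: lift_res_diffS.
  rewrite !mulmxBl mul1mx -!mulmxA -g1P -S0P mulmxBr mulmx1 mulmxA f1D.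
  by rewrite -scalemxAr -scalemxAl opprB addrA subrK subrr.
exists f1, g1, S0, S1; split=> //.
by rewrite -S1P -[_ - _ - _]addrA -opprD [RHS]addrC subrK.
Qed.

(** The resolution [0 -> A -> A] is zero in degrees at least 2, so there the identity of [F] is
    itself null-homotopic. *)
Lemma contractionS i : exists S S', 1%:M = d i.+1 *m S + S' *m d i.+2.
Proof.
elim: i => [|i [S [S' SS']]].
  have [f1 [g1 [S0 [S1 [f1D SP]]]]] := contraction1.
  have [S2 S2P] : exists S2, 1%:M - d 1 *m S1 = S2 *m d 2.
    apply: lift_res_diffS; rewrite mulmxBl mul1mx -mulmxA.
    have -> : S1 *m d 1 = 1%:M - f1 *m g1 - d 0 *m S0.
      by rewrite SP -[RHS]addrA -opprD [RHS]addrC addKr.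
    rewrite !mulmxBr mulmx1 !mulmxA res_diffK mul0mx subr0.
    (* [D *: (d 1 *m f1) = d 1 *m d 0 *m aug = 0], and [D] can be cancelled. *)
    suff -> : d 1 *m f1 = 0 by rewrite mul0mx subr0 subrr.
    apply/matrixP=> s t; rewrite [RHS]mxE; apply: D_reg.
    have := res_diffK 0 => /(congr1 (fun M => (M *m aug) s t)).
    by rewrite -mulmxA f1D -scalemxAr mul0mx mxE [RHS]mxE mulrC.
  by exists S1, S2; rewrite -S2P addrC subrK.
have [S2 S2P] : exists S2, 1%:M - d i.+2 *m S' = S2 *m d i.+3.
  apply: lift_res_diffS; rewrite mulmxBl mul1mx -mulmxA.
  have -> : S' *m d i.+2 = 1%:M - d i.+1 *m S by rewrite SS' addrC addKr.
  by rewrite mulmxBr mulmx1 mulmxA res_diffK mul0mx subr0 subrr.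
by exists S', S2; rewrite -S2P addrC subrK.
Qed.

Lemma Tor_boundaries_submodule i : submodule (@Tor_boundaries _ I J F i).
Proof.
split=> [|a u v [w uw] [w' vw']].
  by exists 0 => j; rewrite mul0mx subr0 mxE; apply: ideal0.
exists (a *: w + w') => j.
have -> : (a *: u + v - (a *: w + w') *m d i) 0 j =
    a * (u - w *m d i) 0 j + (v - w' *m d i) 0 j.
  rewrite mulmxDl -scalemxAl !mxE mulrBr addrACA; congr (_ + _).
  by rewrite opprD.
by apply: idealD => //; apply: idealMl.
Qed.

(** The homotopy writes a cycle [v] as a boundary plus a multiple of its differential, which has
    entries in [J]. In degree 1 there is an extra term through [v *m f1]; its product with [D] lies
    in [J], and [D] is regular modulo [J]. *)
Lemma Tor_principal_pos i :
  (forall a, J (a * D) -> J a) -> Tor_has_length J F i.+1 0.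
Proof.
move=> D_regJ.
have CB : @Tor_cycles _ I J F i.+1 `<=` @Tor_boundaries _ I J F i.+1.
  move=> v /= Jv; case: i v Jv => [|i] v Jv.
    have [f1 [g1 [S0 [S1 [f1D SP]]]]] := contraction1.
    exists (v *m S1) => j.
    have -> : v - v *m S1 *m d 1 = v *m f1 *m g1 + v *m d 0 *m S0.
      by rewrite -{1}[v]mulmx1 SP !mulmxDr !mulmxA addrK.
    rewrite mxE; apply: idealD => //; apply: ideal_mulmx => // l.
    rewrite (ord1 l); apply: D_regJ.
    have -> : (v *m f1) 0 0 * D = (v *m d 0 *m aug) 0 0.
      by rewrite -mulmxA f1D -scalemxAr [RHS]mxE mulrC.
    exact: ideal_mulmx.
  have [S [S' SP]] := contractionS i.
  exists (v *m S') => j.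
  have -> : v - v *m S' *m d i.+2 = v *m d i.+1 *m S.
    by rewrite -{1}[v]mulmx1 SP !mulmxDr !mulmxA addrK.
  exact: ideal_mulmx.
have BC : @Tor_boundaries _ I J F i.+1 `<=` @Tor_cycles _ I J F i.+1.
  move=> v [w vw] /= j.
  have -> : v *m d i = (v - w *m d i.+1) *m d i.
    by rewrite mulmxBl -mulmxA res_diffK mulmx0 subr0.
  exact: ideal_mulmx.
have eqCB : @Tor_cycles _ I J F i.+1 = @Tor_boundaries _ I J F i.+1.
  by apply/seteqP; split.
apply: (@has_length_flag _ _ _ _ 0 (fun=> @Tor_boundaries _ I J F i.+1)) => //.
- by move=> *; apply: Tor_boundaries_submodule.
- by move=> N _ BN NC; exists 0%N => //; apply/seteqP; split; rewrite // -eqCB.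
Qed.

(* Tor_0 is A / (I + J); the flag O of ideals between I + J and A is pulled
   back along the augmentation. *)
Lemma Tor_principal0 (O : nat -> set A) (m : nat) :
  (forall i, ideal (O i)) -> I `<=` O 0%N -> J `<=` O 0%N ->
  (forall a, O 0%N a -> exists b c, [/\ I b, J c & a = b + c]) ->
  O m = setT ->
  (forall i, O i `<=` O i.+1) ->
  (forall i, (i < m)%N -> exists2 a, O i.+1 a & ~ O i a) ->
  (forall N, ideal N -> O 0%N `<=` N -> exists2 i, (i <= m)%N & N = O i) ->
  Tor_has_length J F 0 m.
Proof.
move=> O_id IO JO OIJ OT Ole Olt Oall.
have O0 i : O 0%N `<=` O i by elim: i => // i IHi; apply: subset_trans (Ole i).
have [u Iu] := aug_section.
pose al (v : 'rV_(res_rank F 0)) := (v *m aug) 0 0.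
have alD a v w : al (a *: v + w) = a * al v + al w.
  by rewrite /al mulmxDl -scalemxAl !mxE.
have alZ a v : al (a *: v) = a * al v by rewrite /al -scalemxAl mxE.
have alB v w : al (v - w) = al v - al w by rewrite /al mulmxBl !mxE.
have bI v : I (al v) -> @Tor_boundaries _ I J F 0 v.
  move=> /res_exact0[w ->]; exists w => j; rewrite subrr mxE; exact: ideal0.
have bJ a : J a -> @Tor_boundaries _ I J F 0 (a *: u).
  move=> Ja; exists 0 => j; rewrite mul0mx subr0 mxE; exact: idealMr.
have b_al v : I (al (v - al v *: u)).
  rewrite alB alZ -[X in X - _]mulr1 -mulrBr; exact: idealMl.
(* Modulo boundaries, [v] equals [al v *: u], so the boundaries are exactly the preimage of [I + J]
   under [al]. *)
have bE v : @Tor_boundaries _ I J F 0 v <-> O 0%N (al v).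
  split=> [[w vw]|/OIJ[b [c [Ib Jc vbc]]]].
    rewrite -[v](subrK (w *m d 0)) -[X in X + _]scale1r alD mul1r.
    apply: idealD => //; first by apply: JO; apply: ideal_mulmx.
    by apply: IO; apply/res_exact0; exists w.
  have /bI Bvc : I (al (v - c *: u)).
    rewrite alB alZ vbc -addrA -[X in _ + (X - _)]mulr1 -mulrBr.
    by apply: idealD => //; apply: idealMl.
  have := (Tor_boundaries_submodule 0).2 1 _ _ Bvc (bJ c Jc).
  by rewrite scale1r subrK.
apply: (@has_length_flag _ _ _ _ m (fun i => [set v | O i (al v)])).
- move=> i _; split=> /= [|a v w Ov Ow].
    by rewrite /al mul0mx mxE; apply: ideal0.
  by rewrite alD; apply: idealD => //; apply: idealMl.
- by apply/seteqP; split=> v /= /bE.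
- by rewrite OT; apply/seteqP; split.
- move=> i lt_im; split=> [v|sub]; first exact: Ole.
  have [a Oa nOa] := Olt i lt_im; apply: nOa.
  (* [al u] is 1 modulo [I], so [al (a *: u)] and [a] agree modulo [O j]. *)
  have au j : O j (al (a *: u)) <-> O j a.
    have Oj : O j (a - al (a *: u)).
      rewrite alZ -[X in X - _]mulr1 -mulrBr; apply: idealMl => //.
      exact/O0/IO.
    split=> H; last first.
      by rewrite -[al _](subKr a); apply: idealB.
    by rewrite -[a](subrK (al (a *: u))); apply: idealD.
  by apply/au; apply: sub => /=; apply/au.
- move=> N N_sub BN _.
  (* [N] contains the boundaries, hence is determined by its trace on the line spanned by [u], which
     is an ideal of [A]. *)
  have [|a Oa|i le_im NO] := Oall [set a | N (a *: u)].
  + split=> /= [|a b c Nb Nc]; first by rewrite scale0r; case: N_sub.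
    by rewrite scalerDl -scalerA; apply: N_sub.2.
  + apply: BN; apply/bE; rewrite alZ; exact: idealMr.
  exists i => //; rewrite -NO; apply/seteqP; split=> v /= Nv.
    have := N_sub.2 (-1) _ _ (BN _ (bI _ (b_al v))) Nv.
    by rewrite scaleN1r opprB subrK.
  have := N_sub.2 1 _ _ (BN _ (bI _ (b_al v))) Nv.
  by rewrite scale1r subrK.
Qed.

End PrincipalTor.

(** * Fractions and extended ideals in the local ring *)

Section LocalRing.
Variables (k : fieldType) (N : nat) (c : 'I_N -> k).
Implicit Types (p q : {mpoly k[N]}) (a b : local_ring c).
Local Notation loc := (to_local c).

Fact to_local_is_zmod_morphism : zmod_morphism loc.
Proof. by move=> p q; apply: val_inj; rewrite /= rmorphB. Qed.
HB.instance Definition _ :=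
  GRing.isZmodMorphism.Build _ _ loc to_local_is_zmod_morphism.

Fact to_local_is_monoid_morphism : monoid_morphism loc.
Proof.
by split=> [|p q]; apply: val_inj; rewrite /= ?rmorph1 ?rmorphM.
Qed.
HB.instance Definition _ :=
  GRing.isMonoidMorphism.Build _ _ loc to_local_is_monoid_morphism.

Lemma to_local_inj : injective loc.
Proof.
by move=> p q /(congr1 val)/= /eqP; rewrite tofrac_eq => /eqP.
Qed.

Lemma to_local_reg p a : p != 0 -> a * loc p = 0 -> a = 0.
Proof.
move=> p0 /(congr1 val)/= /eqP; rewrite mulf_eq0 tofrac_eq0 (negPf p0) orbF.
by move=> /eqP a0; apply: val_inj.
Qed.

Lemma meval_neq0 q : q.@[c] != 0 -> q != 0.
Proof. by apply: contraNneq => ->; rewrite meval0. Qed.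

Lemma to_local_rep a :
  exists p q, q.@[c] != 0 /\ a * loc q = loc p.
Proof.
have /asboolP[p [q [q0 apq]]] := valP a.
exists p, q; split=> //; apply: val_inj; rewrite /= apq divfK //.
by rewrite tofrac_eq0 meval_neq0.
Qed.

Lemma to_local_unit q : q.@[c] != 0 -> exists a, a * loc q = 1.
Proof.
move=> q0; have qV : (tofrac q)^-1 \in regular_at c.
  by apply/asboolP; exists 1, q; rewrite rmorph1 div1r.
exists (LocalRing qV); apply: val_inj; rewrite /= mulVf //.
by rewrite tofrac_eq0 meval_neq0.
Qed.

(** Fractions with numerator in [I] are stable under linear combinations, by passing to a common
    denominator; so they already form the whole extended ideal. *)
Lemma ideal_atP (I : set {mpoly k[N]}) : ideal I -> forall a,
  ideal_at c I a <-> exists p q, [/\ q.@[c] != 0, a * loc q = loc p & I p].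
Proof.
move=> I_id a; split=> [|[p [q [q0 apq Ip]]]]; last first.
  have [b bq] := to_local_unit q0.
  rewrite -[a]mulr1 -bq mulrCA apq.
  apply: (idealMl (ideal_gen_ideal _)); apply: sub_gen_smallest.
  by exists p.
apply: (@smallest_sub _ _ _ [set a | exists p q,
  [/\ q.@[c] != 0, a * loc q = loc p & I p]]) => [|_ [p Ip <-]]; last first.
  by exists p, 1; rewrite meval1 oner_neq0 rmorph1 mulr1.
split=> [|b u v [p [q [q0 upq Ip]]] [p' [q' [q'0 vpq' Ip']]]].
  exists 0, 1; rewrite meval1 oner_neq0 mul0r rmorph0; split=> //.
  exact: ideal0 I_id.
have [s [r [r0 brs]]] := to_local_rep b.
exists (s * q' * p + r * q * p'), (r * q * q'); split.
- by rewrite !mevalM !mulf_neq0.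
- rewrite rmorphD !rmorphM /= -brs -upq -vpq'.
  rewrite (_ : b *: (u : _^o) = b * u) //; ring.
- by apply: (idealD I_id); apply: (idealMl I_id).
Qed.

Lemma ideal_at_gen1 p a :
  ideal_at c (ideal_gen [set p]) a <-> exists b, a = b * loc p.
Proof.
rewrite (ideal_atP (ideal_gen_ideal _)); split=> [[p' [q [q0 aq]]]|[b ->]].
  rewrite ideal_gen1 => -[r p'E]; have [u uq] := to_local_unit q0.
  exists (loc r * u).
  by rewrite mulrAC -rmorphM /= -p'E -aq -mulrA [_ * u]mulrC uq mulr1.
have [s [q [q0 bq]]] := to_local_rep b.
exists (s * p), q; split=> //; first by rewrite mulrAC bq rmorphM.
by apply/ideal_gen1; exists s.
Qed.

End LocalRing.

(** * Intersection of a hypersurface with an embedded affine line *)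

Lemma mup_factor (k : fieldType) (f : {poly k}) (x : k) : f != 0 ->
  exists2 h, ~~ root h x & f = ('X - x%:P) ^+ mup x f * h.
Proof.
move=> f0; have [m [h]] := multiplicity_XsubC f x; rewrite f0 /= => hx fE.
by exists h => //; rewrite {2}fE mupMr // mup_XsubCX eqxx mulrC.
Qed.

(* phi presents the affine line as a closed subscheme of affine space with
   ideal J, passing through c at the parameter value x. *)
Section LineSection.
Variables (k : fieldType) (N : nat) (c : 'I_N -> k) (x : k).
Variables (phi : {rmorphism {mpoly k[N]} -> {poly k}}).
Variables (lift : {poly k} -> {mpoly k[N]}).
Hypothesis phi_eval : forall p, (phi p).[x] = p.@[c].
Hypothesis liftK : cancel lift phi.
Variable J : set {mpoly k[N]}.
Hypothesis J_phi : forall p, J p <-> phi p = 0.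
Variable D : {mpoly k[N]}.
Hypothesis D_neq0 : phi D != 0.

Local Notation loc := (to_local c).
Local Notation t := ('X - x%:P).
Let m := mup x (phi D).

(** The preimage of the [i]-th power of the maximal ideal of the discrete valuation ring [A / J].
    The denominator does not affect the order, as [phi q] is nonzero at [x]. *)
Definition order_ge i : set (local_ring c) :=
  [set a | exists p q, [/\ q.@[c] != 0, a * loc q = loc p & t ^+ i %| phi p]].

Lemma kernel_ideal : ideal J.
Proof.
split=> [|a u v /J_phi Ju /J_phi Jv]; apply/J_phi; first by rewrite rmorph0.
by rewrite rmorphD rmorphM Ju Jv mulr0 addr0.
Qed.
Let J_id := kernel_ideal.

Lemma order_ge_ideal i : ideal (order_ge i).
Proof.
split=> [|b u v [p [q [q0 upq dp]]] [p' [q' [q'0 vpq' dp']]]].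
  exists 0, 1; rewrite meval1 oner_neq0 mul0r !rmorph0 dvdp0; split=> //.
have [s [r [r0 brs]]] := to_local_rep b.
exists (s * q' * p + r * q * p'), (r * q * q'); split.
- by rewrite !mevalM !mulf_neq0.
- rewrite rmorphD !rmorphM /= -brs -upq -vpq'.
  by rewrite (_ : b *: (u : _^o) = b * u) //; ring.
- by rewrite rmorphD !rmorphM dvdp_add // dvdp_mull.
Qed.

Lemma order_ge_leq i j : (i <= j)%N -> order_ge j `<=` order_ge i.
Proof.
move=> le_ij a [p [q [q0 apq dp]]]; exists p, q; split=> //.
exact: dvdp_trans (dvdp_exp2l _ le_ij) dp.
Qed.

Lemma order_ge0 : order_ge 0 = setT.
Proof.
apply/seteqP; split=> // a _; have [p [q [q0 apq]]] := to_local_rep a.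
by exists p, q; rewrite expr0 dvd1p.
Qed.

Lemma order_ge_kernel i : ideal_at c J `<=` order_ge i.
Proof.
move=> a /(ideal_atP J_id)[p [q [q0 apq /J_phi p0]]].
by exists p, q; rewrite p0 dvdp0.
Qed.

(** [t ^+ i] has order exactly [i]: a higher order would make [t] divide [phi q], whose value at [x]
    is [q.@[c]]. *)
Lemma order_ge_strict i : ~ order_ge i.+1 (loc (lift (t ^+ i))).
Proof.
case=> p [q [q0]]; rewrite -rmorphM /= => /to_local_inj <-.
rewrite rmorphM liftK exprSr dvdp_mul2l ?expf_neq0 ?polyXsubC_eq0 //.
by rewrite dvdp_XsubCl /root phi_eval (negPf q0).
Qed.

Lemma order_ge_lift i : order_ge i (loc (lift (t ^+ i))).
Proof.
exists (lift (t ^+ i)), 1.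
by rewrite meval1 oner_neq0 rmorph1 mulr1 liftK.
Qed.

(* A / J is a discrete valuation ring with uniformizer t. *)
Lemma order_ge_div (a b : local_ring c) (p q : {mpoly k[N]}) (h : {poly k}) j :
  q.@[c] != 0 -> a * loc q = loc p -> phi p = t ^+ j * h -> ~~ root h x ->
  order_ge j b -> exists e, ideal_at c J (b - e * a).
Proof.
move=> q0 apq phip hx [p' [q' [q'0 bpq' /dvdpP[h' phip']]]].
have lh0 : (lift h).@[c] != 0 by rewrite -phi_eval liftK.
(* On the line, [b / a] is [(h' / q') / (h / q)]; this is a fraction regular at [c] because [h] does
   not vanish at [x]. *)
have [|w wq] := @to_local_unit _ _ c (q' * lift h).
  by rewrite mevalM mulf_neq0.
exists (w * loc (q * lift h')); apply/(ideal_atP J_id).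
exists (p' * lift h - p * lift h'), (q' * lift h); split.
- by rewrite mevalM mulf_neq0.
- rewrite mulrBl mulrAC [w * _ * _]mulrAC wq mul1r rmorphB !rmorphM /=.
  by rewrite -bpq' -apq; ring.
- apply/J_phi; rewrite rmorphB !rmorphM phip phip' !liftK; ring.
Qed.

(** [D] has order exactly [m], so modulo [J] it divides every element of order at least [m]. *)
Lemma order_ge_mup (a : local_ring c) :
  order_ge m a -> exists e, ideal_at c J (a - e * loc D).
Proof.
have [h hx phiD] := mup_factor x D_neq0.
by apply: (@order_ge_div _ _ D 1 h); rewrite ?meval1 ?oner_neq0 ?rmorph1 ?mulr1.
Qed.

(** Take the least [i] with [order_ge i] inside [M]. An element of [M] of order [j < i] would
    generate [order_ge j] modulo [J], contradicting minimality. *)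
Lemma order_ge_classify (M : set (local_ring c)) :
  ideal M -> order_ge m `<=` M -> exists2 i, (i <= m)%N & M = order_ge i.
Proof.
move=> M_id mM.
have exM : exists i, `[< order_ge i `<=` M >] by exists m; apply/asboolP.
case: (ex_minnP exM) => i /asboolP iM i_min.
have le_im : (i <= m)%N by apply/i_min/asboolP.
exists i => //; apply/seteqP; split=> // a Ma.
have [p [q [q0 apq]]] := to_local_rep a.
exists p, q; split=> //.
have [->|p0] := eqVneq (phi p) 0; first by rewrite dvdp0.
rewrite -mup_geq // leqNgt; apply/negP => lt_ji.
have [h hx phip] := mup_factor x p0.
suff /i_min : `[< order_ge (mup x (phi p)) `<=` M >] by rewrite leqNgt lt_ji.
apply/asboolP => b jb.
have [e /(@order_ge_kernel m _)/mM Mbe] := order_ge_div q0 apq phip hx jb.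
rewrite -[b](subrK (e * a)); apply: idealD => //; exact: idealMl.
Qed.

Lemma intersection_mult_line :
  is_intersection_mult (ideal_gen [set D]) J c m.
Proof.
have D0 : D != 0 by apply: contraNneq D_neq0 => ->; rewrite rmorph0.
have I_D := @ideal_at_gen1 _ _ c D.
have D_reg a : a * loc D = 0 -> a = 0 by apply: to_local_reg.
have Jc_id : ideal (ideal_at c J) by apply: ideal_gen_ideal.
split=> [|F]; first exact: principal_free_resolution I_D D_reg.
exists (fun i => if i is 0 then m else 0%N); last first.
  rewrite big_ord_recl /= expr0 mul1r big1 ?addr0 // => i _.
  by rewrite mulr0.
case=> [|i] _; last first.
  (* [D] is regular modulo [J] because [phi] lands in a domain where neither [phi D] nor [phi q] is
     zero. *)
  apply: Tor_principal_pos => // a /(ideal_atP J_id)[p [q [q0 aDpq /J_phi p0]]].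
  have [s [r [r0 ars]]] := to_local_rep a.
  apply/(ideal_atP J_id); exists s, r; split=> //; apply/J_phi.
  have : s * D * q = p * r.
    by apply: (@to_local_inj _ _ c); rewrite !rmorphM /= -ars -aDpq; ring.
  move=> /(congr1 phi); rewrite !rmorphM p0 mul0r => /eqP.
  have q1 : phi q != 0.
    by apply: contraNneq q0; rewrite -phi_eval => ->; rewrite horner0.
  by rewrite !mulf_eq0 (negPf q1) (negPf D_neq0) !orbF => /eqP.
(* The flag has to increase from [I + J], which is [order_ge m], to the whole ring [order_ge 0];
   hence the reversed index. *)
apply: (@Tor_principal0 _ _ _ _ I_D Jc_id F (fun i => order_ge (m - i)%N)).
- by move=> i; apply: order_ge_ideal.
- rewrite subn0 => a /I_D[b ->]; have [s [r [r0 ars]]] := to_local_rep b.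
  exists (s * D), r; split=> //; first by rewrite mulrAC ars rmorphM.
  by rewrite rmorphM dvdp_mull // -mup_geq.
- exact: order_ge_kernel.
- rewrite subn0 => a /order_ge_mup[e Je].
  exists (e * loc D), (a - e * loc D); split=> //; last by rewrite addrC subrK.
  by apply/I_D; exists e.
- by rewrite subnn order_ge0.
- by move=> i; apply: order_ge_leq; apply: leq_sub2l.
- move=> i lt_im; exists (loc (lift (t ^+ (m - i.+1)))).
    exact: order_ge_lift.
  by rewrite -[(m - i)%N]subSS subSn //; apply: order_ge_strict.
- rewrite subn0 => M M_id /order_ge_classify[//|i le_im ->].
  by exists (m - i)%N; rewrite ?leq_subr // subKn.
Qed.

End LineSection.

(** Both values are read off one and the same resolution, where lengths are unique. *)
Lemma is_intersection_mult_inj (k : fieldType) (N : nat)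
    (I J : set {mpoly k[N]}) (c : 'I_N -> k) (e e' : int) :
  is_intersection_mult I J c e -> is_intersection_mult I J c e' -> e = e'.
Proof.
move=> [[F] /(_ F)[l lP ->]] [_ /(_ F)[l' l'P ->]].
apply: eq_bigr => i _; congr (_ * _%:Z).
by apply: has_length_inj (lP _ _) (l'P _ _); rewrite -ltnS.
Qed.

Lemma intersection_multE (k : fieldType) (N : nat)
    (I J : set {mpoly k[N]}) (c : 'I_N -> k) (e : int) :
  is_intersection_mult I J c e -> intersection_mult I J c = e.
Proof.
move=> Ie; apply: is_intersection_mult_inj (Ie); apply: xgetPex.
by exists e.
Qed.

(** * The resolution of the curve as an embedded line *)

Section CurveIdeal.
Variables (k : closedFieldType) (n : nat) (L : 'M[{poly k}]_n).
Local Notation R := {mpoly k[1 + n * n]}.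

Definition curve_coord (u : 'I_(1 + n * n)) : {poly k} :=
  match split u with inl _ => 'X | inr v => mxvec L 0 v end.

Definition curve_subst : {rmorphism R -> {poly k}} := mmap polyC curve_coord.

(** Sends a polynomial to the same polynomial in lambda alone, giving a section of [curve_subst]. *)
Definition param_lift : {rmorphism {poly k} -> R} :=
  horner_eval 'X_(param_idx n) \o map_poly (@mpolyC (1 + n * n) k).

Lemma curve_substXU u : curve_subst 'X_u = curve_coord u.
Proof. by rewrite /= mmapX mmap1U. Qed.

Lemma curve_coord_param : curve_coord (param_idx n) = 'X.
Proof. by rewrite /curve_coord /param_idx (unsplitK (inl _)). Qed.

Lemma curve_coord_entry i j : curve_coord (entry_idx i j) = L i j.
Proof. by rewrite /curve_coord /entry_idx (unsplitK (inr _)) mxvecE. Qed.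

Lemma idx_cases (P : 'I_(1 + n * n) -> Prop) :
  P (param_idx n) -> (forall i j, P (entry_idx i j)) -> forall u, P u.
Proof.
move=> P0 PS u; rewrite -(splitK u); case: (split u) => [v|v].
  by rewrite (ord1 v).
by case/mxvec_indexP: v => i j; apply: PS.
Qed.

Lemma param_liftK : cancel param_lift curve_subst.
Proof.
move=> f; rewrite /= /horner_eval -horner_map /=.
rewrite -map_poly_comp mmapX mmap1U curve_coord_param.
rewrite (eq_map_poly (g := polyC)) => [|a]; last by rewrite /= mmapC.
exact: comp_polyXr.
Qed.

Lemma curve_subst_eval (x : k) (p : R) :
  (curve_subst p).[x] = p.@[curve_point L x].
Proof.
rewrite /= /mmap horner_sum mevalE; apply: eq_bigr => mo _.
rewrite hornerM hornerC /mmap1 horner_prod; congr (_ * _).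
apply: eq_bigr => u _; rewrite horner_exp; congr (_ ^+ _).
rewrite /curve_coord /curve_point; case: (split u) => [_|v].
  exact: hornerX.
by case/mxvec_indexP: v => i j; rewrite !mxvecE mxE.
Qed.

(** Modulo the ideal each matrix entry may be replaced by its polynomial in lambda, so every [p] is
    congruent to the lift of its substitution. *)
Lemma resolution_idealP (p : R) :
  resolution_ideal L p <-> curve_subst p = 0.
Proof.
have J_id : ideal (resolution_ideal L) by apply: ideal_gen_ideal.
split=> [|p0].
  apply: (@smallest_sub _ _ _ [set p | curve_subst p = 0]) => [|_ [[i j] _ <-]].
    split=> [|a u v u0 v0]; first exact: rmorph0.
    by rewrite /= rmorphD rmorphM u0 v0 mulr0 addr0.
  rewrite [X in _ - X](_ : _ = param_lift (L i j)) //=.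
  rewrite rmorphB [X in _ - X]param_liftK.
  by rewrite [X in X - _]curve_substXU curve_coord_entry subrr.
rewrite -[p]subr0 -(rmorph0 param_lift) -p0 => {p0}.
(* [Q] holds for constants and variables and is stable under sums and products, hence holds
   everywhere. *)
pose Q q := resolution_ideal L (q - param_lift (curve_subst q)).
have QM q r : Q q -> Q r -> Q (q * r).
  move=> Qq Qr; rewrite /Q !rmorphM.
  set q' := param_lift _; set r' := param_lift _.
  have -> : q * r - q' * r' = r * (q - q') + q' * (r - r') by ring.
  by apply: (idealD J_id) => //; apply: (idealMl J_id).
have Q1 : Q 1 by rewrite /Q !rmorph1 subrr; apply: (ideal0 J_id).
have QC (a : k) : Q a%:MP.
  rewrite /Q /= mmapC /horner_eval map_polyC hornerC subrr.
  exact: (ideal0 J_id).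
have QX : forall u, Q 'X_u.
  apply: idx_cases => [|i j]; rewrite /Q curve_substXU.
    rewrite curve_coord_param /= /horner_eval map_polyX hornerX subrr.
    exact: (ideal0 J_id).
  rewrite curve_coord_entry; apply: sub_gen_smallest.
  by exists (i, j).
have QD q r : Q q -> Q r -> Q (q + r).
  by move=> Qq Qr; rewrite /Q !rmorphD opprD addrACA; apply: (idealD J_id).
rewrite -/(Q p); elim/mpolyind: p => [|a mo p _ _ Qp].
  by rewrite /Q !rmorph0 subrr; apply: (ideal0 J_id).
rewrite -mul_mpolyC; apply: (QD) => //; apply: (QM) => //.
rewrite mpolyXE_id; elim/big_ind: _ => // u _.
by elim: (mo u) => [|e IHe]; rewrite ?expr0 // exprS; apply: QM.
Qed.

Lemma curve_subst_det :
  curve_subst (\det (\matrix_(i, j) ('X_(entry_idx i j) : R))) = \det L.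
Proof.
rewrite -det_map_mx; congr (\det _); apply/matrixP=> i j.
by rewrite !mxE curve_substXU curve_coord_entry.
Qed.

Lemma curve_intersection_mult (x : k) : \det L != 0 ->
  is_intersection_mult (singular_ideal k n) (resolution_ideal L)
    (curve_point L x) (alg_mult L x).
Proof.
move=> detL0; rewrite /alg_mult -curve_subst_det.
apply: (intersection_mult_line (lift := param_lift)).
- exact: curve_subst_eval.
- exact: param_liftK.
- exact: resolution_idealP.
- by rewrite curve_subst_det.
Qed.

End CurveIdeal.

(** * Degree of the determinant and count of its roots *)

(** Here [a] and [b] only bound the degrees. In degree [a + b], any other pair of indices exceeds
    one of the bounds. *)
Lemma size_mul_bound (R : nzRingType) (f g : {poly R}) (a b : nat) :
  (size f <= a.+1)%N -> (size g <= b.+1)%N ->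
  (size (f * g)%R <= (a + b).+1)%N /\ (f * g)`_(a + b) = f`_a * g`_b.
Proof.
move=> sf sg; split.
  apply: leq_trans (size_polyMleq _ _) _.
  rewrite -ltnS; case: (size f + size g)%N (leq_add sf sg) => // s.
  by rewrite addnS.
have lt_a : (a < (a + b).+1)%N by rewrite ltnS leq_addr.
rewrite coefM (bigD1 (Ordinal lt_a)) //= addKn big1 ?addr0 // => i.
rewrite -val_eqE /= neq_ltn => /orP[lt_ia|lt_ai].
  rewrite [g`__]nth_default ?mulr0 //; apply: leq_trans sg _.
  by rewrite -[ltnRHS]addnBAC ?(ltnW lt_ia) // -add1n leq_add2r subn_gt0.
by rewrite nth_default ?mul0r //; apply: leq_trans sf _.
Qed.

Lemma size_prod_bound (R : nzRingType) (I : Type) (s : seq I)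
    (f : I -> {poly R}) (d : nat) :
  (forall i, size (f i) <= d.+1)%N ->
  (size (\prod_(i <- s) f i)%R <= (d * size s).+1)%N /\
  (\prod_(i <- s) f i)`_(d * size s) = \prod_(i <- s) (f i)`_d.
Proof.
move=> sf; elim: s => [|i s [IHs IHc]].
  by rewrite muln0 !big_nil size_poly1 coef1.
by rewrite !big_cons /= mulnS -IHc; apply: size_mul_bound.
Qed.

(** Each Leibniz term is a product of [n] entries, so its coefficient of degree [d * n] is the
    product of their coefficients of degree [d]. *)
Lemma size_det_bound (R : comNzRingType) (n d : nat) (M : 'M[{poly R}]_n) :
  (forall i j, size (M i j) <= d.+1)%N ->
  (size (\det M)%R <= (d * n).+1)%N /\
  (\det M)`_(d * n) = \det (map_mx (coefp d) M).
Proof.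
move=> sM.
have sn : size (index_enum 'I_n) = n by rewrite -sum1_size sum1_card card_ord.
have bound (s : 'I_n -> 'I_n) :=
  size_prod_bound (index_enum 'I_n) (fun i => sM i (s i)).
split.
  apply: (leq_trans (size_sum _ _ _)); apply/bigmax_leqP => s _.
  have [sz _] := bound (perm.fun_of_perm s); rewrite sn in sz.
  apply: leq_trans sz.
  by rewrite size_Msign.
rewrite /determinant coef_sum; apply: eq_bigr => s _.
have [_ cE] := bound (perm.fun_of_perm s); rewrite sn in cE.
rewrite [X in _ = _ * X](eq_bigr (fun i => (M i (perm.fun_of_perm s i))`_d));
  last by move=> i _; rewrite mxE.
rewrite -cE; case: (perm.odd_perm s); rewrite ?expr0 ?mul1r //.
by rewrite expr1 !mulN1r coefN.
Qed.

(** Over an algebraically closed field [f] splits; multiplicities count occurrences in the list [r]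
    of roots, so they add up to its length. *)
Lemma sum_mup (k : closedFieldType) (f : {poly k}) : f != 0 ->
  \sum_(x \in [set x | root f x]) (mup x f)%:Z = (size f).-1%:Z.
Proof.
move=> f0; have [r fE] := closed_field_poly_normal f.
have lf0 : lead_coef f != 0 by rewrite lead_coef_eq0.
have mupE x : mup x f = count_mem x r.
  by rewrite fE -mul_polyC mupMr ?rootC // mu_prod_XsubC.
have -> : [set x | root f x] = [set` undup r].
  apply/seteqP; split=> x /=.
    by rewrite {1}fE rootZ // root_prod_XsubC mem_undup.
  by rewrite {1}fE rootZ // root_prod_XsubC mem_undup.
rewrite -fsbig_seq ?undup_uniq //.
rewrite {2}fE size_scale // size_prod_XsubC /= -sum1_size.
rewrite (eq_bigr (fun x => 1 *+ count_mem x r)) => [|x _]; last first.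
  by rewrite mupE natz.
rewrite [LHS](big_undup_iterop_count +%R r xpredT (fun=> 1)).
by rewrite big_const_seq count_predT iter_addr_0 sum1_size natz.
Qed.

(** At [mu = 0] only the term of index [curve_deg L] survives, with [0 ^+ 0 = 1]. *)
Lemma curve_bar_infty (k : closedFieldType) (n : nat) (L : 'M[{poly k}]_n) :
  (curve_bar L 1 0).2 = map_mx (coefp (curve_deg L)) L.
Proof.
apply/matrixP=> i j; rewrite !mxE big_ord_recr /= subnn expr0 expr1n !mulr1.
rewrite big1 ?add0r // => t _.
by rewrite expr0n subn_eq0 leqNgt ltn_ord mulr0.
Qed.

(** The determinant at infinity is the coefficient of [\det L] at the largest degree allowed, so the
    degree bound is attained. *)
Lemma size_det_curve (k : closedFieldType) (n : nat) (L : 'M[{poly k}]_n) :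
  \det (curve_bar L 1 0).2 != 0 -> size (\det L) = (curve_deg L * n).+1.
Proof.
rewrite curve_bar_infty => detL.
have [|sz cE] := @size_det_bound _ _ (curve_deg L) L.
  (* This form also covers zero entries, whose size is 0. *)
  move=> i j; apply: leq_trans (leqSpred _) _; rewrite ltnS.
  exact: (@leq_bigmax _ (fun ij => (size (L ij.1 ij.2)).-1) (i, j)).
apply/eqP; rewrite eqn_leq sz ltnNge; apply/negP => sz'.
by rewrite -cE nth_default ?eqxx in detL.
Qed.

Lemma det_curve_eval (k : closedFieldType) (n : nat) (L : 'M[{poly k}]_n) x :
  \det (curve_eval L x) = (\det L).[x].
Proof.
rewrite -[RHS]/(horner_eval x _) -det_map_mx.
by congr (\det _); apply/matrixP=> i j; rewrite !mxE.
Qed.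

Theorem theorem3p2 (k : closedFieldType) (n : nat) (n_gt0 : (0 < n)%N)
    (L : 'M[{poly k}]_n) (L_curve : operator_curve L)
    (Sigma_eq : Some @` Sigma L = Sigma_bar L)
    (Sigma_neq : Sigma L <> [set: k]) :
  [/\ forall x, Sigma L x -> exists e : int,
        is_intersection_mult (singular_ideal k n) (resolution_ideal L)
          (curve_point L x) e,
      \sum_(x \in Sigma L) (alg_mult L x)%:Z =
      \sum_(x \in Sigma L)
        intersection_mult (singular_ideal k n) (resolution_ideal L)
          (curve_point L x)
    & \sum_(x \in Sigma L)
        intersection_mult (singular_ideal k n) (resolution_ideal L)
          (curve_point L x) =
      (curve_deg L * n)%:Z].
Proof.
(* A zero determinant at infinity would put [None] in [Sigma_bar L], whereas the image of [Some]
   does not contain it. *)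
have detbar : \det (curve_bar L 1 0).2 != 0.
  apply/eqP => det0; have : Sigma_bar L None by right.
  by rewrite -Sigma_eq => -[].
have sz := size_det_curve detbar.
have detL : \det L != 0 by rewrite -size_poly_gt0 sz.
have mult x := curve_intersection_mult x detL.
have sum_eq : \sum_(x \in Sigma L) (alg_mult L x)%:Z = \sum_(x \in Sigma L)
    intersection_mult (singular_ideal k n) (resolution_ideal L)
      (curve_point L x).
  by apply: eq_fsbigr => x _; rewrite (intersection_multE (mult x)).
split=> [x _||] //; first by exists (alg_mult L x).
rewrite -sum_eq (_ : Sigma L = [set x | root (\det L) x]).
  by rewrite sum_mup // sz.
by apply/seteqP; split=> x; rewrite /Sigma /= det_curve_eval => /rootP.
Qed.
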